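(* Let $n$ be a natural number. Let $P$ be a predicate on families with $P(\emptyset)$ true, let $v_{[\,]}=\{\emptyset\}$, and let $Q$ be a predicate on pairs (family, set) that incrementally checks $P$ and is preserved by injective functions. Let $L_{\max}$ be a list of natural numbers of length at most $n+1$, let $\mathcal{L}_s$ be a set of lists all of length equal to the length of $L_{\max}$, and let $\mathrm{stop}(L)$ hold iff $L\succeq L_s$ for some $L_s\in\mathcal{L}_s$. Let $\Pi$ be a list containing all permutations of $[n]$ and $\mathrm{upd}(\mathcal{F},m)=\mathrm{base}(\mathcal{F}\otimes_Q\mathcal{S}(n,m),\Pi)$. Let $X$ be the set of lists $L$ (of the same length as $L_{\max}$) with $L\preceq L_{\max}$ such that there is no $L_s\in\mathcal{L}_s$ with $L\succeq L_s$. Then for every $L\in X$ there is a member $\mathcal{F}_b$ of the list $\mathrm{enum\_dp}(v_{[\,]},\mathrm{upd},\mathrm{stop},L_{\max})$ that is an iso-base of $\mathcal{L}(L,n,P)$.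
   Context: All sets and families are finite; sets are sets of natural numbers, $[n]=\{0,\ldots,n-1\}$, and a family $F$ is over $[n]$ if $\bigcup F\subseteq[n]$. For a list $L=[l_0,\ldots,l_m]$, $F$ is $L$-partitioned if every $A\in F$ has $|A|\le m$ and for each $0\le i\le m$ exactly $l_i$ members of $F$ have $i$ elements. $\mathcal{L}(L,n,P)$ is the collection of $L$-partitioned families over $[n]$ satisfying $P$. $\mathcal{S}(n,m)$ is the collection of $m$-element subsets of $[n]$. For lists of equal length, $L'\preceq L$ (equivalently $L\succeq L'$) means $L'$ is pointwise $\le L$. For a collection $\mathcal{F}$ and a family $G$, $\mathcal{F}\otimes_Q G=\bigcup_{A\in G}\{F\cup\{A\}:F\in\mathcal{F},A\notin F,Q\,F\,A\}$. $Q$ incrementally checks $P$ if for every family $F$ and set $A$ with $|A|\ge|A'|$ for all $A'\in F$ and $A\notin F$: $P(F\cup\{A\})\iff(P(F)\text{ and }Q\,F\,A)$. $Q$ is preserved by injective functions if for all $F,A$ and $f$ injective on $\bigcup F\cup A$, $Q\,F\,A$ implies $Q\,\{f[B]:B\in F\}\,f[A]$. Families $F,F'$ are isomorphic if there is a bijection $f:\bigcup F\to\bigcup F'$ with $\{f[B]:B\in F\}=F'$. A collection $\mathcal{F}_b$ is an iso-base of $\mathcal{F}$ if every member of $\mathcal{F}$ is isomorphic to some member of $\mathcal{F}_b$ and no two distinct members of $\mathcal{F}_b$ are isomorphic. $\mathrm{base}(\mathcal{F},\Pi)$ is computed by sieving: repeatedly choose a member $F$ of the remaining collection, put it into the result,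 and remove from the remaining collection all families $\{\pi[B]:B\in F\}$ for $\pi\in\Pi$ (and $F$ itself), until nothing remains. For a list $L$ and position $j$, $\mathrm{inc}(L,j)$ is $L$ with its $j$-th entry (0-based) increased by one. Define $\mathrm{enum\_dp\_aux}(L,m,v,\mathrm{res})$ (with fixed $\mathrm{upd},\mathrm{stop},L_{\max}$) as the result of a left fold over the positions $m'=m,m+1,\ldots,|L|-1$ in this order, with initial accumulator the list $v\#\mathrm{res}$ ($v$ prepended to $\mathrm{res}$), where each step, with current accumulator $\mathrm{res}'$ and $L'=\mathrm{inc}(L,m')$, returns $\mathrm{res}'$ if $\mathrm{stop}(L')$ holds or $L'\not\preceq L_{\max}$, and otherwise returns $\mathrm{enum\_dp\_aux}(L',m',\mathrm{upd}(v,m'),\mathrm{res}')$. Finally $\mathrm{enum\_dp}(v_{[\,]},\mathrm{upd},\mathrm{stop},L_{\max})=\mathrm{enum\_dp\_aux}([0,\ldots,0],0,v_{[\,]},[\,])$ where $[0,\ldots,0]$ has the length of $L_{\max}$. *)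

(* Defs.v *)
From mathcomp Require Import all_boot perm.
From mathcomp Require Import finmap.
From mathcomp Require Import boolp classical_sets.

Set Implicit Arguments.
Unset Strict Implicit.
Unset Printing Implicit Defensive.

Local Open Scope fset_scope.

Notation natset := {fset nat}.
Notation natfamily := {fset {fset nat}}.
(* Finite collections of families; a collection that is not built by a finite
   computation is a [set natfamily]. *)
Notation collection := {fset {fset {fset nat}}}.

(* [n] = {0, ..., n-1} *)
Definition segment (n : nat) : natset := [fset i in iota 0 n].

Definition family_over (n : nat) (F : natfamily) : Prop :=
  fcover F `<=` segment n.

(* For L = [l_0; ...; l_m], [size L] is m + 1, so [#|` A| < size L] is
   "|A| <= m"; for the empty list it forces F to be empty. *)
Definition partitioned (L : seq nat) (F : natfamily) : Prop :=
  (forall A, A \in F -> #|` A| < size L) /\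
  (forall i, i < size L -> #|` [fset A in F | #|` A| == i]| = nth 0 L i).

Definition partitioned_families (L : seq nat) (n : nat)
    (P : natfamily -> Prop) : set natfamily :=
  [set F | partitioned L F /\ family_over n F /\ P F]%classic.

Definition subsets_of_size (n m : nat) : natfamily :=
  [fset A in fpowerset (segment n) | #|` A| == m].

(* Pointwise comparison; [all2] is false on lists of different lengths. *)
Definition pointwise_le (L' L : seq nat) : bool := all2 leq L' L.

Definition extend (Q : natfamily -> natset -> Prop) (C : collection)
    (G : natfamily) : collection :=
  \bigcup_(A <- G) [fset A |` F | F in C & (A \notin F) && `[< Q F A >]].

Definition incrementally_checks (Q : natfamily -> natset -> Prop)
    (P : natfamily -> Prop) : Prop :=
  forall (F : natfamily) (A : natset),
    (forall A', A' \in F -> #|` A'| <= #|` A|) -> A \notin F ->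
    (P (A |` F) <-> P F /\ Q F A).

(* { f[B] : B in F } *)
Definition family_image (f : nat -> nat) (F : natfamily) : natfamily :=
  [fset f @` (B : natset) | B in F].

Definition preserved_by_injections (Q : natfamily -> natset -> Prop) : Prop :=
  forall (F : natfamily) (A : natset) (f : nat -> nat),
    {in fcover F `|` A &, injective f} ->
    Q F A -> Q (family_image f F) (f @` A).

(* A bijection between the two unions is given by a function on nat that is
   injective on the first union and maps it onto the second one. *)
Definition isomorphic (F F' : natfamily) : Prop :=
  exists f : nat -> nat,
    [/\ {in fcover F &, injective f},
        f @` fcover F = fcover F' &
        family_image f F = F'].

Definition iso_base (Cb : collection) (C : set natfamily) : Prop :=
  (forall F, C F -> exists2 Fb, Fb \in Cb & isomorphic F Fb) /\
  (forall F F', F \in Cb -> F' \in Cb -> F <> F' -> ~ isomorphic F F').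

(* [sieve Pi C R]: R is a possible result of sieving C, with an arbitrary
   choice of the member F at each step. *)
Inductive sieve (Pi : seq (nat -> nat)) : collection -> collection -> Prop :=
| sieve_empty : sieve Pi fset0 fset0
| sieve_step (C R : collection) (F : natfamily) :
    F \in C ->
    sieve Pi
      [fset F' in C | F' \notin F :: [seq family_image p F | p <- Pi]] R ->
    sieve Pi C (F |` R).

(* A function computing the sieve under some choice strategy. *)
Definition computes_sieve
    (base : collection -> seq (nat -> nat) -> collection) : Prop :=
  forall C Pi, sieve Pi C (base C Pi).

Lemma sieve_total Pi C : exists R, sieve Pi C R.
Proof.
have [k] := ubnP #|` C|; elim: k C => // k IHk C; rewrite ltnS => leCk.
have [->|[F FC]] := fset_0Vmem C; first by exists fset0; apply: sieve_empty.
pose C' := [fset F' in C | F' \notin F :: [seq family_image p F | p <- Pi]].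
have [R sR] : exists R, sieve Pi C' R.
  apply: IHk; apply: leq_trans leCk; apply: fproper_ltn_card.
  rewrite fproperEneq fset_sub andbT; apply: contraTneq FC => <-.
  by rewrite !inE eqxx andbF.
by exists (F |` R); apply: sieve_step sR.
Qed.

Lemma computes_sieve_exists : exists base, computes_sieve base.
Proof.
exists (fun C Pi => projT1 (cid (sieve_total Pi C))) => C Pi.
exact: projT2 (cid (sieve_total Pi C)).
Qed.

(* A permutation of [n] as a function on nat, fixing every i >= n. *)
Definition nat_of_perm (n : nat) (s : 'S_n) (i : nat) : nat :=
  if insub i is Some j then val (s j) else i.

Section EnumDP.
Variables (V : Type) (upd : V -> nat -> V) (stop : pred (seq nat)).
Variable Lmax : seq nat.

(* [incr_nth L j] increases the entry of L at position j.  The argument k bounds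
   the recursion depth; [enum_dp_auxE] shows that the bound chosen in
   [enum_dp_aux] never interferes. *)
Fixpoint enum_dp_rec (k : nat) (L : seq nat) (m : nat) (v : V) (res : seq V) :
    seq V :=
  foldl (fun res' m' =>
           let L' := incr_nth L m' in
           if stop L' || ~~ pointwise_le L' Lmax then res'
           else if k is k'.+1 then enum_dp_rec k' L' m' (upd v m') res'
           else res')
        (v :: res) (iota m (size L - m)).

Definition enum_dp_aux (L : seq nat) (m : nat) (v : V) (res : seq V) : seq V :=
  enum_dp_rec (sumn Lmax - sumn L) L m v res.

Lemma pointwise_le_sumn (L' L : seq nat) :
  pointwise_le L' L -> sumn L' <= sumn L.
Proof.
elim: L' L => [|x L' IH] [|y L] //= /andP[xy /IH].
exact: leq_add.
Qed.

Lemma sumn_incr (L : seq nat) (i : nat) : sumn (incr_nth L i) = (sumn L).+1.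
Proof.
elim: L i => [|x L IH] [|i] //=; last by rewrite IH addnS.
by rewrite sumn_ncons mul0n.
Qed.

Lemma enum_dp_auxE (L : seq nat) (m : nat) (v : V) (res : seq V) :
  enum_dp_aux L m v res =
  foldl (fun res' m' =>
           let L' := incr_nth L m' in
           if stop L' || ~~ pointwise_le L' Lmax then res'
           else enum_dp_aux L' m' (upd v m') res')
        (v :: res) (iota m (size L - m)).
Proof.
have E (L1 : seq nat) i : pointwise_le (incr_nth L1 i) Lmax ->
    sumn Lmax - sumn L1 = (sumn Lmax - sumn (incr_nth L1 i)).+1.
  by move=> /pointwise_le_sumn; rewrite sumn_incr => lt; rewrite -subSn ?subSS.
rewrite /enum_dp_aux.
case k_eq: (sumn Lmax - sumn L) => [|k] /=.
  elim: (iota m _) (v :: res) => //= i s IH r; rewrite -IH; congr foldl.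
  case: ifP => // /norP[_]; rewrite negbK => /E.
  by rewrite k_eq.
elim: (iota m _) (v :: res) => //= i s IH r; rewrite -IH; congr foldl.
case: ifP => // /norP[_]; rewrite negbK => /E.
by rewrite k_eq => -[<-].
Qed.

Definition enum_dp (v0 : V) : seq V :=
  enum_dp_aux (nseq (size Lmax) 0) 0 v0 [::].

End EnumDP.

(* Main.v *)
Require Import Defs.
From mathcomp Require Import all_boot perm.
From mathcomp Require Import finmap.
From mathcomp Require Import boolp classical_sets.

(* For families over [n], isomorphism is the orbit relation of 'S_n, since a
   partial injection of [n] into itself extends to a permutation; so sieving by
   all permutations returns one representative per isomorphism class.  Removing
   a set A of maximal size m from a family in L(inc(L, m), n, P) leaves a family
   in L(L, n, P), isomorphic to a representative via some permutation s, and
   adding s(A) to this representative is allowed because Q is preserved by s.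
   Hence the update step turns a base for L into a base for inc(L, m) whenever L
   vanishes beyond m.  The enumeration reaches a given L by filling its positions
   from left to right; all lists on the way are pointwise below L, so neither
   Lmax nor the stop test interrupts it. *)

Local Open Scope fset_scope.

(** * Covers and images of families *)

Lemma mem_segment n i : (i \in segment n) = (i < n).
Proof. by rewrite !inE mem_iota. Qed.

Lemma fcoverP (F : natfamily) i :
  reflect (exists2 A, A \in F & i \in A) (i \in fcover F).
Proof.
apply: (iffP (bigfcupP _ _ _ _)) => -[A AF iA]; exists A => //.
  by case/andP: AF.
by rewrite AF.
Qed.

Lemma fcover1U A (F : natfamily) : fcover (A |` F) = A `|` fcover F.
Proof.
apply/fsetP => i; rewrite inE; apply/fcoverP/orP.
  by case=> B /fset1UP[->|BF] iB; [left | right; apply/fcoverP; exists B].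
by case=> [iA|/fcoverP[B BF iB]]; [exists A | exists B];
  rewrite // !inE ?eqxx ?BF ?orbT.
Qed.

Lemma family_over1U n A F :
  family_over n (A |` F) <-> A `<=` segment n /\ family_over n F.
Proof. by rewrite /family_over fcover1U fsubUset; split=> /andP. Qed.

Lemma fcover_family_image (f : nat -> nat) (F : natfamily) :
  fcover (family_image f F) = f @` fcover F.
Proof.
apply/fsetP => i; apply/fcoverP/imfsetP => /=.
  case=> _ /imfsetP[A /= AF ->] /imfsetP[j /= jA ->].
  by exists j => //; apply/fcoverP; exists A.
case=> j /fcoverP[A AF jA] ->; exists (f @` A); first exact: in_imfset.
exact: in_imfset.
Qed.

Lemma family_image1U (f : nat -> nat) (A : natset) (F : natfamily) :
  family_image f (A |` F) = (f @` A) |` family_image f F.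
Proof. exact: imfsetU1. Qed.

Lemma eq_in_family_image (f g : nat -> nat) (F : natfamily) :
  {in fcover F, f =1 g} -> family_image f F = family_image g F.
Proof.
move=> eqfg; apply: eq_in_imfset => A /= AF; apply: eq_in_imfset => i /= iA.
by apply: eqfg; apply/fcoverP; exists A.
Qed.

Lemma family_image_id (F : natfamily) : family_image id F = F.
Proof.
rewrite -[RHS]imfset_id; apply: eq_imfset => // A /=.
exact: imfset_id.
Qed.

Lemma family_image_comp (f g : nat -> nat) (F : natfamily) :
  family_image g (family_image f F) = family_image (g \o f) F.
Proof.
rewrite /family_image -imfset_comp; apply: eq_imfset => // A.
exact: esym (imfset_comp _ _ _ _).
Qed.

Lemma imfset_natset_inj (f : nat -> nat) :
  injective f -> injective (fun A : natset => f @` A).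
Proof.
move=> f_inj A B eqAB; apply/fsetP => i.
by rewrite -[LHS](mem_imfset imfset_key _ f_inj) -[RHS](mem_imfset imfset_key _ f_inj) eqAB.
Qed.

Lemma mem_family_image (f : nat -> nat) (A : natset) (F : natfamily) :
  injective f -> (f @` A \in family_image f F) = (A \in F).
Proof. by move=> f_inj; rewrite mem_imfset //; apply: imfset_natset_inj. Qed.

(** * Permutations of [n], isomorphism of families over [n], and sieving *)

Section Permutations.
Variable n : nat.
Implicit Types (s t : 'S_n) (F : natfamily).

Lemma nat_of_permM s t i :
  nat_of_perm (s * t)%g i = nat_of_perm t (nat_of_perm s i).
Proof.
rewrite /nat_of_perm; case: insubP => [j _ _|lti]; last by rewrite insubN.
by rewrite valK permM.
Qed.

Lemma nat_of_perm1 i : nat_of_perm (1%g : 'S_n) i = i.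
Proof.
by rewrite /nat_of_perm; case: insubP => [j _ <-|//]; rewrite perm1.
Qed.

Lemma nat_of_perm_inj s : injective (nat_of_perm s).
Proof.
move=> i j /(congr1 (nat_of_perm s^-1)%g).
by rewrite -!nat_of_permM mulgV !nat_of_perm1.
Qed.

Lemma nat_of_perm_ord s (i : 'I_n) : nat_of_perm s i = s i.
Proof. by rewrite /nat_of_perm valK. Qed.

Lemma imfset_perm_sub s (A : natset) :
  A `<=` segment n -> nat_of_perm s @` A `<=` segment n.
Proof.
move=> /fsubsetP sA; apply/fsubsetP => _ /imfsetP[i /= /sA + ->].
rewrite !mem_segment => lti; rewrite -[i]/(val (Ordinal lti)).
by rewrite nat_of_perm_ord ltn_ord.
Qed.

(** Induction on [r]: the permutation [s] found for the tail is followed by the transposition of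
    [s x] and [f x]. This corrects the value at [x] and moves no other [s i] with [i] in [r], since
    both [s] and [f] are injective there. *)
Lemma injection_extends_to_perm (f : 'I_n -> 'I_n) (r : seq 'I_n) :
  {in r &, injective f} -> exists s : 'S_n, {in r, s =1 f}.
Proof.
elim: r => [|x r IHr] f_inj; first by exists 1%g.
have [|s sf] := IHr; first by move=> i j ri rj; apply: f_inj; rewrite inE ?ri ?rj orbT.
exists (s * tperm (s x) (f x))%g => i; rewrite inE permM.
have [-> _|neq_ix /= ri] := eqVneq i x; first by rewrite tpermL.
have neq_sx : s x != s i by rewrite (inj_eq perm_inj) eq_sym.
have neq_fx : f x != s i.
  rewrite sf //; apply: contraNneq neq_ix => /f_inj eqf.
  by rewrite eqf // !inE ?eqxx ?ri ?orbT.
by rewrite tpermD // sf.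
Qed.

Definition perm_isomorphic F F' : Prop :=
  exists s : 'S_n, family_image (nat_of_perm s) F = F'.

Lemma perm_isomorphic_refl F : perm_isomorphic F F.
Proof.
exists 1%g; rewrite -[RHS]family_image_id.
by apply: eq_in_family_image => i _; apply: nat_of_perm1.
Qed.

Lemma perm_isomorphic_trans F1 F2 F3 :
  perm_isomorphic F1 F2 -> perm_isomorphic F2 F3 -> perm_isomorphic F1 F3.
Proof.
case=> s <- [t <-]; exists (s * t)%g; rewrite family_image_comp.
by apply: eq_in_family_image => i _; apply: nat_of_permM.
Qed.

Lemma perm_isomorphic_sym F F' : perm_isomorphic F F' -> perm_isomorphic F' F.
Proof.
case=> s <-; exists (s^-1)%g; rewrite family_image_comp -[RHS]family_image_id.
by apply: eq_in_family_image => i _ /=; rewrite -nat_of_permM mulgV nat_of_perm1.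
Qed.

Lemma perm_isomorphicW F F' : perm_isomorphic F F' -> isomorphic F F'.
Proof.
case=> s eqF'; exists (nat_of_perm s); split=> //.
  by move=> i j _ _; apply: nat_of_perm_inj.
by rewrite -fcover_family_image eqF'.
Qed.

(** Off the cover of [F] the given bijection is arbitrary, but on it the values lie in the cover of
    [F'], hence in [n]. It is therefore a partial injection of [n] and extends to a permutation. *)
Lemma isomorphic_perm F F' : family_over n F -> family_over n F' ->
  isomorphic F F' -> perm_isomorphic F F'.
Proof.
move=> /fsubsetP overF /fsubsetP overF' [f [f_inj fF <-]].
(* The default [i] is taken only when [f i] is outside [n], which cannot happen on the cover of
   [F]. *)
pose g (i : 'I_n) : 'I_n := insubd i (f i).
have gE (i : 'I_n) : val i \in fcover F -> val (g i) = f i.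
  move=> iF; rewrite insubdK // -[_ \in _]mem_segment; apply: overF'.
  by rewrite -fF; apply: in_imfset.
pose r := [seq i <- enum 'I_n | val i \in fcover F].
have rE (i : 'I_n) : (i \in r) = (val i \in fcover F).
  by rewrite mem_filter mem_enum andbT.
have [|s sg] := @injection_extends_to_perm g r.
  move=> i j; rewrite !rE => iF jF /(congr1 val); rewrite /= !gE // => /f_inj.
  by move=> /(_ iF jF)/val_inj.
exists s; apply: eq_in_family_image => i iF.
have lti : i < n by rewrite -mem_segment overF.
have ri : Ordinal lti \in r by rewrite rE.
by rewrite -[i in LHS]/(val (Ordinal lti)) nat_of_perm_ord sg // gE.
Qed.

(** As [Pi] contains every permutation, each step removes exactly the part of the orbit of [F] lying
    in [C]. What is left contains nothing isomorphic to [F], so [F] cannot clash with a later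
    choice. *)
Lemma sieve_spec (Pi : seq 'S_n) (C R : collection) :
    (forall s, s \in Pi) -> sieve [seq nat_of_perm s | s <- Pi] C R ->
  [/\ R `<=` C,
      forall F, F \in C -> exists2 F', F' \in R & perm_isomorphic F F' &
      {in R &, forall F F', F <> F' -> ~ perm_isomorphic F F'}].
Proof.
move=> all_perms; set fPi := map _ _; elim=> {C R} [|C R F FC _].
  by split=> // F; rewrite inE.
set C' := [fset F' in C | _] => -[RC' C'R R_iso].
have isoF F' : F' \in F :: [seq family_image p F | p <- fPi] <-> perm_isomorphic F F'.
  rewrite inE; split.
    case/predU1P=> [->|/mapP[_ /mapP[s _ ->] ->]]; last by exists s.
    exact: perm_isomorphic_refl.
  case=> s <-; rewrite orbC; apply/orP; left; apply/mapP; exists (nat_of_perm s) => //.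
  exact: map_f.
have notisoF F' : F' \in R -> ~ perm_isomorphic F F'.
  by move=> /(fsubsetP RC'); rewrite !inE /= => /andP[_ /negP nF] /isoF.
split.
- rewrite fsubUset fsub1set FC; apply: fsubset_trans RC' _; exact: fset_sub.
- move=> F' F'C.
  have [/isoF iF'|niF'] := boolP (F' \in F :: [seq family_image p F | p <- fPi]).
    by exists F; [rewrite !inE eqxx | apply: perm_isomorphic_sym].
  have [|F'' F''R iso] := C'R F'; first by rewrite !inE /= F'C.
  by exists F''; rewrite // !inE F''R orbT.
- move=> F1 F2 /fset1UP[->|F1R] /fset1UP[->|F2R] // neqF.
  + exact: notisoF.
  + by move=> /perm_isomorphic_sym; apply: notisoF.
  + exact: R_iso.
Qed.

End Permutations.

(** * Counting members by size when one set is added *)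

Lemma partitioned1U (L : seq nat) (A : natset) (F : natfamily) :
    #|` A| < size L -> A \notin F ->
  partitioned (incr_nth L #|` A|) (A |` F) <-> partitioned L F.
Proof.
move=> ltA AF; rewrite /partitioned size_incr_nth ltA.
(* Since [A] is new to [F], it adds one to the class of its own size and nothing to the others. *)
have cardE i : #|` [fset B in A |` F | #|` B| == i]| =
    ((#|` A| == i) + #|` [fset B in F | #|` B| == i]|)%N.
  have -> : [fset B in A |` F | #|` B| == i] =
      if #|` A| == i then A |` [fset B in F | #|` B| == i]
      else [fset B in F | #|` B| == i].
    apply/fsetP => B; case: ifP => cardA; rewrite !inE /=.
      by case: (eqVneq B A) => [->|].
    by case: (eqVneq B A) => [->|//]; rewrite cardA !andbF.
  by case: eqVneq => _ //; rewrite cardfsU1 !inE /= (negPf AF).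
split=> -[ltF cardF]; split=> [B|i ltiL].
- by move=> BF; apply: ltF; rewrite !inE BF orbT.
- by have := cardF i ltiL; rewrite cardE nth_incr_nth => /addnI.
- by case/fset1UP=> [->|/ltF].
- by rewrite cardE nth_incr_nth cardF.
Qed.

(** * Bases of the collections L(L, n, P) and the update step *)

Section Enumeration.
Variables (n : nat) (P : natfamily -> Prop) (P_empty : P fset0).
Variables (Q : natfamily -> natset -> Prop).
Hypotheses (Q_checks_P : incrementally_checks Q P)
           (Q_preserved : preserved_by_injections Q).

(* Unlike [iso_base], this also asks that the representatives belong to the
   collection: the induction needs it, as only such families can be extended. *)
Definition perm_base (Cb : collection) (L : seq nat) : Prop :=
  [/\ forall F, F \in Cb -> partitioned_families L n P F,
      forall F, partitioned_families L n P F ->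
        exists2 Fb, Fb \in Cb & perm_isomorphic n F Fb &
      {in Cb &, forall F F', F <> F' -> ~ perm_isomorphic n F F'}].

(** The representatives are families over [n], so an isomorphism between two of them would be given
    by a permutation. *)
Lemma perm_base_iso_base Cb L :
  perm_base Cb L -> iso_base Cb (partitioned_families L n P).
Proof.
case=> subCb Cb_all Cb_iso; split=> [F /Cb_all[Fb FbCb isoF]|F F' FCb F'Cb neqF].
  by exists Fb => //; apply: perm_isomorphicW isoF.
have [[_ [overF _]] [_ [overF' _]]] := (subCb _ FCb, subCb _ F'Cb).
by move=> /(isomorphic_perm _ _ _ overF overF'); apply: Cb_iso.
Qed.

Lemma perm_base_nil k : perm_base [fset fset0] (nseq k 0).
Proof.
have mem0 F : partitioned_families (nseq k 0) n P F -> F = fset0.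
  case=> pF _; case: (fset_0Vmem F) => // -[A AF]; case: pF => ltF /(_ _ (ltF A AF)).
  rewrite nth_nseq if_same => /cardfs0_eq/fsetP/(_ A).
  by rewrite !inE /= AF eqxx.
split=> [F|F /mem0->|F F'].
- rewrite inE => /eqP->; split; last by rewrite /family_over /fcover big_seq_fset0 fsub0set.
  split=> [A|i _]; first by rewrite inE.
  rewrite nth_nseq if_same; apply/eqP; rewrite cardfs_eq0; apply/eqP/fsetP => A.
  by rewrite !inE.
- by exists fset0; [rewrite inE | apply: perm_isomorphic_refl].
- by rewrite !inE => /eqP-> /eqP->.
Qed.

Lemma extendP (C : collection) (G F : natfamily) :
  F \in extend Q C G <-> exists A F0,
    [/\ A \in G, F0 \in C, A \notin F0, Q F0 A & F = A |` F0].
Proof.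
split.
  case/bigfcupP=> A; rewrite andbT => AG /imfsetP[F0 /=].
  rewrite inE => /and3P[F0C AF0 /asboolP QA] ->.
  by exists A, F0.
case=> A [F0 [AG F0C AF0 QA ->]]; apply/bigfcupP; exists A; first by rewrite AG.
by apply/imfsetP; exists F0; rewrite //= inE F0C AF0; apply/asboolP.
Qed.

Lemma mem_subsets_of_size m (A : natset) :
  (A \in subsets_of_size n m) = (A `<=` segment n) && (#|` A| == m).
Proof. by rewrite !inE fpowersetE. Qed.

(** A larger member would make a vanishing entry of [L] positive. This bound supplies the maximality
    of the added set that [incrementally_checks] requires. *)
Lemma partitioned_card_le {L : seq nat} {m} {F : natfamily} {A : natset} :
    (forall i, m < i -> nth 0 L i = 0) -> partitioned L F ->
  A \in F -> #|` A| <= m.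
Proof.
move=> L0 [ltF cardF] AF; rewrite leqNgt; apply/negP => /L0.
rewrite -cardF ?ltF // => /cardfs0_eq/fsetP/(_ A).
by rewrite !inE AF eqxx.
Qed.

Lemma partitioned_families1U (L : seq nat) (A : natset) (F : natfamily) :
    #|` A| < size L -> (forall i, #|` A| < i -> nth 0 L i = 0) -> A \notin F ->
  partitioned_families (incr_nth L #|` A|) n P (A |` F) <->
  [/\ partitioned_families L n P F, A `<=` segment n & Q F A].
Proof.
move=> ltA L0 AF.
have PE : partitioned L F -> P (A |` F) <-> P F /\ Q F A.
  by move=> pF; apply: Q_checks_P => // B; apply: partitioned_card_le L0 pF.
split.
  case=> /(partitioned1U _ _ _ ltA AF) pF [/family_over1U[sA overF]].
  by case/(PE pF).
case=> -[pF [overF PF]] sA QA; split; first exact/partitioned1U.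
by split; [apply/family_over1U | apply/PE].
Qed.

Section Step.
Variables (Pi : seq 'S_n) (base : collection -> seq (nat -> nat) -> collection).
Hypotheses (all_perms : forall s : 'S_n, s \in Pi)
           (base_sieve : computes_sieve base).

Let upd (C : collection) (m : nat) : collection :=
  base (extend Q C (subsets_of_size n m)) [seq nat_of_perm s | s <- Pi].

Lemma perm_base_upd Cb (L : seq nat) m :
    m < size L -> (forall i, m < i -> nth 0 L i = 0) -> perm_base Cb L ->
  perm_base (upd Cb m) (incr_nth L m).
Proof.
move=> ltm L0 [subCb Cb_all Cb_iso].
have [subR R_all R_iso] := sieve_spec n Pi _ _ all_perms
  (base_sieve (extend Q Cb (subsets_of_size n m)) [seq nat_of_perm s | s <- Pi]).
split=> // [F /(fsubsetP subR)/extendP|F].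
  case=> A [F0 [+ F0C AF0 QA ->]].
  rewrite mem_subsets_of_size => /andP[sA /eqP cardA].
  by rewrite -cardA in ltm L0 *; apply/partitioned_families1U => //; split=> //; apply: subCb.
move=> memF; have [[_ cardF] _] := memF.
(* Entry [m] of the incremented list is positive, so there is a set of size [m] to take out. *)
have [A AF cardA] : exists2 A, A \in F & #|` A| = m.
  have := cardF m; rewrite size_incr_nth ltm nth_incr_nth eqxx => /(_ ltm).
  have [->|[A]] := fset_0Vmem [fset A in F | #|` A| == m].
    by rewrite cardfs0.
  by rewrite !inE /= => /andP[AF /eqP]; exists A.
pose F0 := F `\ A.
have AF0 : A \notin F0 by rewrite !inE eqxx.
rewrite -cardA in ltm L0 memF.
rewrite -(fsetD1K AF) -/F0 in memF *.
have [/Cb_all[Fb FbCb [s sF]] sA QA] := (partitioned_families1U _ _ _ ltm L0 AF0).1 memF.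
have s_inj := @nat_of_perm_inj n s.
(* Adding the image of [A] under [s] to [Fb] gives the image of the whole family. That image is thus
   among the sieved extensions, and its representative also serves for the original family. *)
have [|F' F'R isoF'] := R_all (family_image (nat_of_perm s) (A |` F0)).
  apply/extendP; exists (nat_of_perm s @` A), Fb.
  rewrite family_image1U sF -sF; split=> //.
  - rewrite mem_subsets_of_size imfset_perm_sub //= -cardA.
    exact/eqP/card_imfset.
  - by rewrite sF.
  - by rewrite mem_family_image.
  - by apply: Q_preserved => // i j _ _; apply: s_inj.
by exists F' => //; apply: (perm_isomorphic_trans _ _ _ _ _ isoF'); exists s.
Qed.

End Step.
End Enumeration.

(** * Which lists the enumeration reaches *)

Section EnumDP.
Variables (V : eqType) (upd : V -> nat -> V) (stop : pred (seq nat)).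
Variable Lmax : seq nat.

Let step (L : seq nat) (v : V) (res : seq V) (i : nat) : seq V :=
  let L' := incr_nth L i in
  if stop L' || ~~ pointwise_le L' Lmax then res
  else enum_dp_aux upd stop Lmax L' i (upd v i) res.

(** Every step passes its accumulator on, so results are never lost. The induction is on
    [sumn Lmax - sumn L], which drops strictly in each recursive call because the incremented list
    is still below [Lmax]. *)
Lemma enum_dp_aux_sub L m v res :
  {subset v :: res <= enum_dp_aux upd stop Lmax L m v res}.
Proof.
have [k] := ubnP (sumn Lmax - sumn L).
elim: k => // k IHk in L m v res *; rewrite ltnS => leLk.
rewrite enum_dp_auxE; elim: (iota _ _) (v :: res) => [r x|i s IHs r x xr] //=.
apply: IHs; case: ifP => // /norP[_]; rewrite negbK => /pointwise_le_sumn.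
rewrite sumn_incr => ltL; apply: IHk; last by rewrite inE xr orbT.
by rewrite sumn_incr; apply: leq_trans leLk; rewrite ltn_sub2l.
Qed.

Lemma pointwise_leP (L' L : seq nat) : reflect
  (size L' = size L /\ forall i, nth 0 L' i <= nth 0 L i) (pointwise_le L' L).
Proof.
elim: L' L => [|x L' IH] [|y L] /=; try by constructor; case.
  by constructor; split.
apply: (iffP andP) => [[lexy /IH[-> leL]]|[[eqsz] leL]].
  by split=> // -[|i] /=.
split; first exact: (leL 0).
by apply/IH; split=> // i; apply: (leL i.+1).
Qed.

Lemma pointwise_le_trans (L1 L2 L3 : seq nat) :
  pointwise_le L1 L2 -> pointwise_le L2 L3 -> pointwise_le L1 L3.
Proof.
move=> /pointwise_leP[sz12 le12] /pointwise_leP[sz23 le23].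
apply/pointwise_leP; split=> [|i]; first by rewrite sz12.
exact: leq_trans (le12 i) (le23 i).
Qed.

Hypothesis stop_mono :
  forall L1 L2, pointwise_le L1 L2 -> stop L1 -> stop L2.

(** [I] is an invariant tying a value to its list. The call at [L'] agrees with the target [L]
    before [m] and vanishes after [m]. Incrementing the first position where they differ preserves
    this shape and brings [L'] closer to [L], so induction on the difference of the sums applies. *)
Lemma enum_dp_aux_complete (I : V -> seq nat -> Prop) (L : seq nat) :
    (forall v L' m, m < size L' -> (forall i, m < i -> nth 0 L' i = 0) ->
       I v L' -> I (upd v m) (incr_nth L' m)) ->
    pointwise_le L Lmax -> ~~ stop L ->
  forall L' m v res, I v L' -> pointwise_le L' L ->
    (forall i, i < m -> nth 0 L' i = nth 0 L i) ->
    (forall i, m < i -> nth 0 L' i = 0) ->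
  exists2 w, w \in enum_dp_aux upd stop Lmax L' m v res & I w L.
Proof.
move=> I_upd leLmax nstopL L' m v res.
have [k] := ubnP (sumn L - sumn L').
elim: k => // k IHk in L' m v res *; rewrite ltnS => leLk IL' /pointwise_leP[sz leL] eqL L'0.
have [eqL'|] := eqVneq L' L.
  by exists v; [apply: enum_dp_aux_sub; rewrite inE eqxx | rewrite -eqL'].
move=> neqL.
(* [j] is the first difference; it exists because the two lists have equal length and are
   distinct. *)
have [|j /andP[ltj neqj] jmin] := @ex_minnP (fun i => (i < size L') && (nth 0 L' i != nth 0 L i)).
  apply: contrapT => noi; case/eqP: neqL; apply: (eq_from_nth (x0 := 0)) => // i lti.
  by apply: contrapT => /eqP neqi; apply: noi; exists i; rewrite lti.
have ltLj : nth 0 L' j < nth 0 L j by rewrite ltn_neqAle neqj leL.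
have lemj : m <= j by rewrite leqNgt; apply: contra neqj => /eqL ->.
have leL1 : pointwise_le (incr_nth L' j) L.
  apply/pointwise_leP; rewrite size_incr_nth ltj; split=> // i.
  by rewrite nth_incr_nth; case: eqVneq => [<-|_]; [exact: ltLj | exact: leL].
have := pointwise_le_sumn leL1; rewrite sumn_incr => ltsum.
have /IHk IH : sumn L - sumn (incr_nth L' j) < k.
  by rewrite sumn_incr; apply: leq_trans leLk; rewrite ltn_sub2l.
rewrite enum_dp_auxE.
(* The fold visits [j]. Steps before it only change the accumulator, for which the induction
   hypothesis is general. *)
have : j \in iota m (size L' - m) by rewrite mem_iota lemj subnKC // (leq_trans lemj (ltnW ltj)).
elim: (iota _ _) (v :: res) => [|a s IHs] r; rewrite inE //=.
case/predU1P=> [<-|/IHs]; last exact.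
have /negPf-> : ~~ (stop (incr_nth L' j) || ~~ pointwise_le (incr_nth L' j) Lmax).
  rewrite negb_or negbK (pointwise_le_trans _ _ _ leL1) // andbT.
  by apply: contra nstopL; apply: stop_mono.
have [|//|i ltij|i ltji|w w_in Iw] := IH j (upd v j) r.
- by apply: I_upd => // i' ltji; apply: L'0; apply: leq_trans ltji.
- rewrite nth_incr_nth gtn_eqF // add0n; apply/eqP/contraT => neqi.
  by have := jmin i; rewrite neqi (ltn_trans ltij ltj) leqNgt ltij => /(_ isT).
- by rewrite nth_incr_nth ltn_eqF // L'0 // (leq_trans _ ltji).
exists w => //.
(* Steps after [j] keep the value found there. *)
have sub s' r' : {subset r' <= foldl (step L' v) r' s'}.
  elim: s' r' => [r' x|i' s' IHs' r' x xr'] //=; apply: IHs'; rewrite /step; case: ifP => // _.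
  by apply: enum_dp_aux_sub; rewrite inE xr' orbT.
exact: sub.
Qed.

End EnumDP.

Theorem theorem6 (n : nat)
    (P : natfamily -> Prop) (P_empty : P fset0)
    (Q : natfamily -> natset -> Prop)
    (Q_checks_P : incrementally_checks Q P)
    (Q_preserved : preserved_by_injections Q)
    (Lmax : seq nat) (size_Lmax : size Lmax <= n.+1)
    (Lstops : set (seq nat))
    (size_Lstops : forall Ls, Lstops Ls -> size Ls = size Lmax)
    (Pi : seq 'S_n) (all_perms : forall s : 'S_n, s \in Pi)
    (base : collection -> seq (nat -> nat) -> collection)
    (base_sieve : computes_sieve base) :
  let v0 : collection := [fset fset0] in
  let stop (L : seq nat) : bool :=
    `[< exists2 Ls, Lstops Ls & pointwise_le Ls L >] in
  let upd (C : collection) (m : nat) : collection :=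
    base (extend Q C (subsets_of_size n m)) [seq nat_of_perm s | s <- Pi] in
  let X : set (seq nat) :=
    [set L | pointwise_le L Lmax /\
             ~ (exists2 Ls, Lstops Ls & pointwise_le Ls L)]%classic in
  forall L, X L ->
    exists2 Fb : collection,
      Fb \in enum_dp upd stop Lmax v0 &
      iso_base Fb (partitioned_families L n P).
Proof.
move=> v0 stop upd X L [leL nstopL].
have [szL _] := pointwise_leP _ _ leL.
have stop_mono L1 L2 : pointwise_le L1 L2 -> stop L1 -> stop L2.
  move=> le12 /asboolP[Ls LLs leLs]; apply/asboolP; exists Ls => //.
  exact: pointwise_le_trans le12.
have upd_base (Cb : collection) (L' : seq nat) m : m < size L' ->
    (forall i, m < i -> nth 0 L' i = 0) ->
    perm_base n P Cb L' -> perm_base n P (upd Cb m) (incr_nth L' m).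
  exact: perm_base_upd.
have zeros i : nth 0 (nseq (size Lmax) 0) i = 0 by rewrite nth_nseq if_same.
have le0L : pointwise_le (nseq (size Lmax) 0) L.
  by apply/pointwise_leP; rewrite size_nseq szL; split=> // i; rewrite zeros.
(* The invariant is [perm_base n P]. At the zero list and position 0, agreement with [L] before the
   position is vacuous and all later entries vanish. *)
have [//|i _|Fb FbE baseFb] := enum_dp_aux_complete _ _ _ _ stop_mono _ _ upd_base leL
  (introN (asboolP _) nstopL) _ 0 v0 [::] (perm_base_nil n P P_empty _) le0L.
  exact: zeros.
exists Fb => //; exact: perm_base_iso_base.
Qed.
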